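(* For each scenario $s\in\mathcal{S}$ let $U_s\in\mathbb{R}$ be an upper bound on $\max_{z,\lambda}Q(z,\lambda,\xi_s)$, the maximum being over all first-stage feasible $(z,\lambda)$. For each $(z^t,\lambda^t)$ feasible to the master problem let $\mathcal{Z}^+_t=\{(v,i)\in\mathcal{V}\times\mathcal{I}: z^t_{vi}=1\}$, $\mathcal{Z}^-_t=\{(v,i)\in\mathcal{V}\times\mathcal{I}: z^t_{vi}=0\}$, $\Lambda^+_t=\{(i,j,l)\in\mathcal{I}\times\mathcal{I}\times\mathcal{L}:\lambda^t_{ijl}=1\}$, $\Lambda^-_t=\{(i,j,l)\in\mathcal{I}\times\mathcal{I}\times\mathcal{L}:\lambda^t_{ijl}=0\}$, and let $Q(z^t,\lambda^t,\xi_s)$ be its second-stage value for scenario $s$. Then the set of cuts $$\phi_s \le \big(Q(z^t,\lambda^t,\xi_s)-U_s\big)\Big(\sum_{(v,i)\in\mathcal{Z}^+_t}z_{vi}-\sum_{(v,i)\in\mathcal{Z}^-_t}z_{vi}+\sum_{(i,j,l)\in\Lambda^+_t}\lambda_{ijl}-\sum_{(i,j,l)\in\Lambda^-_t}\lambda_{ijl}\Big)+U_s-\big(Q(z^t,\lambda^t,\xi_s)-U_s\big)\big(|\mathcal{Z}^+_t|+|\Lambda^+_t|-1\big),\qquad s\in\mathcal{S},$$ defined for all $(z^t,\lambda^t)$ feasible to the master problem, is a valid set of optimality cuts.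
   Context: **Sets and master problem.** $\mathcal{V}$ (vehicles), $\mathcal{I}$ (zones), $\mathcal{L}$ (drop-off fee levels), $\mathcal{K}$ (customers, indexed by integers in order of arrival), $\mathcal{A}$ (alternative transport services) and $\mathcal{S}=\{1,\dots,S\}$ (scenarios) are finite sets. Scenario $s$ has probability $\pi_s$ and realization $\xi_s$. $C^R_{vi}\ge 0$ is the cost of making vehicle $v$ available in zone $i$. The master problem is $$\max\; -\sum_{v\in\mathcal{V}}\sum_{i\in\mathcal{I}}C^R_{vi}z_{vi}+\sum_{s\in\mathcal{S}}\pi_s\phi_s$$ subject to $\sum_{i\in\mathcal{I}}z_{vi}=1$ for $v\in\mathcal{V}$; $\sum_{l\in\mathcal{L}}\lambda_{ijl}=1$ for $i,j\in\mathcal{I}$; $z_{vi}\in\{0,1\}$; $\lambda_{ijl}\in\{0,1\}$; $\phi_s$ free for $s\in\mathcal{S}$. Here $z_{vi}=1$ means that vehicle $v$ is made available in zone $i$, and $\lambda_{ijl}=1$ means that fee level $l$ is applied from $i$ to $j$. A pair $(z,\lambda)$ is called (first-stage) feasible, or feasible to the master problem, if it satisfies these constraints on $z$ and $\lambda$. **Requests.** The fleet is homogeneous. Each customer $k$ has an origin $i$ and a destination $j$. The price of carsharing at level $l$ is $P^VT^{CS}_{ij}+L_l$, where $P^V$ is the per-minute fee, $T^{CS}_{ij}$ the driving time and $L_l\in\mathbb{R}$ the value of fee level $l$; each alternative service has a fixed price. In realization $\xi$, the utility of a service $v\in\mathcal{V}\cup\mathcal{A}$ to customer $k$ is $F_k(\text{price},\text{other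 given characteristics of } v)+\xi_{kv}$, where $F_k$ is a given function, and all vehicles give the customer the same utility. The set $\mathcal{R}(\xi)$ contains exactly one request $r$ for each customer $k$ for which there is some level $l\in\mathcal{L}$ at which the utility of carsharing is strictly greater than that of every alternative service available at the customer's origin. For such a request, $i(r),j(r),k(r)$ are the origin, destination and customer, and $l(r)$ is the level with the highest fee at which the customer strictly prefers carsharing to all available alternatives. Put - $\mathcal{L}_r(\xi)=\{l\in\mathcal{L}:L_l\le L_{l(r)}\}$, - $\mathcal{R}_r(\xi)=\{\rho\in\mathcal{R}(\xi): i(\rho)=i(r),\,k(\rho)<k(r)\}$, - $R_{rl}=P^VT^{CS}_{i(r),j(r)}-C^U_{i(r),j(r)}+L_l$, where $C^U_{ij}$ is the operator's cost of a rental from $i$ to $j$. **Second-stage value.** For feasible $(z,\lambda)$ and a realization $\xi$, $Q(z,\lambda,\xi)$ is the optimal value of $$\max\sum_{r\in\mathcal{R}(\xi)}\sum_{v\in\mathcal{V}}\sum_{l\in\mathcal{L}_r(\xi)}R_{rl}\,y_{vrl}$$ over $y_{vrl}\in\{0,1\}$ ($v\in\mathcal{V}$, $r\in\mathcal{R}(\xi)$, $l\in\mathcal{L}_r(\xi)$) subject to - $\sum_{v\in\mathcal{V}}\sum_{l\in\mathcal{L}_r(\xi)}y_{vrl}\le 1$ for all $r\in\mathcal{R}(\xi)$; - $\sum_{r\in\mathcal{R}(\xi)}\sum_{l\in\mathcal{L}_r(\xi)}y_{vrl}\le 1$ for all $v\in\mathcal{V}$; - $\sum_{l\in\mathcal{L}_{r_1}(\xi)}y_{v,r_1,l}+\sum_{r_2\in\mathcal{R}_{r_1}(\xi)}\sum_{l\in\mathcal{L}_{r_2}(\xi)}y_{v,r_2,l}\le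 z_{v,i(r_1)}$ for all $r_1\in\mathcal{R}(\xi)$, $v\in\mathcal{V}$; - $y_{v,r_1,l_1}+\sum_{r_2\in\mathcal{R}_{r_1}(\xi)}\sum_{l_2\in\mathcal{L}_{r_2}(\xi)}y_{v,r_2,l_2}+\sum_{v_1\in\mathcal{V}:v_1\ne v}y_{v_1,r_1,l_1}\ge\lambda_{i(r_1),j(r_1),l_1}+z_{v,i(r_1)}-1$ for all $r_1\in\mathcal{R}(\xi)$, $v\in\mathcal{V}$, $l_1\in\mathcal{L}_{r_1}(\xi)$; - $\sum_{v\in\mathcal{V}}y_{vrl}\le\lambda_{i(r),j(r),l}$ for all $r\in\mathcal{R}(\xi)$, $l\in\mathcal{L}_r(\xi)$. The second-stage problem is feasible for every first-stage feasible $(z,\lambda)$ (relatively complete recourse), so $Q(z,\lambda,\xi_s)$ is a well-defined real number. **Valid set of optimality cuts.** This is a finite set of optimality cuts which enforces $\phi_s\le Q(z,\lambda,\xi_s)$ for all $s\in\mathcal{S}$. That is, the set consists of finitely many linear inequalities in $(z,\lambda,\phi)$ such that, for every feasible $(z,\lambda)$ and every $\phi\in\mathbb{R}^{\mathcal{S}}$: (i) if $(z,\lambda,\phi)$ satisfies all the inequalities, then $\phi_s\le Q(z,\lambda,\xi_s)$ for all $s\in\mathcal{S}$; (ii) each inequality is an optimality cut, i.e. it is satisfied by $(z,\lambda,\phi)$ whenever $\phi_s\le Q(z,\lambda,\xi_s)$ for all $s\in\mathcal{S}$. *)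

(* Defs.v *)
From HB Require Import structures.
From mathcomp Require Import all_boot all_order all_algebra.
From mathcomp Require Import all_classical all_reals.

Set Implicit Arguments.
Unset Strict Implicit.
Unset Printing Implicit Defensive.
Import Order.TTheory GRing.Theory Num.Theory.
Local Open Scope classical_set_scope.
Local Open Scope ring_scope.

(* Data of the problem: vehicles V, zones I, fee levels L, alternative services
   A, customers 'I_nK numbered in order of arrival, scenarios 'I_nS.
   A service is an element of V + A. *)
Record instance (R : realType) (V I L A : finType) (nK nS : nat) := Instance {
  relocation_cost : V -> I -> R;                 (* C^R *)
  prob : 'I_nS -> R;                             (* pi *)
  orig : 'I_nK -> I;
  dest : 'I_nK -> I;
  minute_fee : R;                                (* P^V *)
  driving_time : I -> I -> R;                    (* T^CS *)
  fee : L -> R;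
  alt_price : A -> R;
  alt_avail : A -> I -> bool;                    (* available at an origin *)
  usage_cost : I -> I -> R;                      (* C^U *)
  charac : Type;
  chr : V + A -> charac;                         (* non-price characteristics *)
  utility_fun : 'I_nK -> R -> charac -> R;       (* F_k *)
  xi : 'I_nS -> 'I_nK -> V + A -> R
}.

Arguments chr {R V I L A nK nS} i _.
Arguments utility_fun {R V I L A nK nS} i _ _ _.

Section Model.
Context {R : realType} {V I L A : finType} {nK nS : nat}.
Variable D : instance R V I L A nK nS.

Definition carsharing_price (i j : I) (l : L) : R :=
  minute_fee D * driving_time D i j + fee D l.

Section Realization.
Variable x : 'I_nK -> V + A -> R.

Definition utility (k : 'I_nK) (price : R) (s : V + A) : R :=
  utility_fun D k price (chr D s) + x k s.

Definition utility_vehicle (k : 'I_nK) (l : L) (v : V) : R :=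
  utility k (carsharing_price (orig D k) (dest D k) l) (inl v).

Definition utility_alt (k : 'I_nK) (a : A) : R :=
  utility k (alt_price D a) (inr a).

(* All vehicles give a customer the same utility (see [standing]), so the
   choice of the vehicle v below is immaterial. *)
Definition prefers_carsharing (k : 'I_nK) (l : L) : bool :=
  [exists v : V, [forall (a : A | alt_avail D a (orig D k)),
    utility_alt k a < utility_vehicle k l v]].

(* The set R(xi): a request is a customer who strictly prefers carsharing at
   some level; k(r) is [val r]. *)
Definition request : finType :=
  {k : 'I_nK | [exists l : L, prefers_carsharing k l]}.

Definition req_orig (r : request) : I := orig D (val r).
Definition req_dest (r : request) : I := dest D (val r).

(* l(r).  If several levels have the same highest fee one of them is taken;
   only its fee is ever used. *)
Definition req_level (r : request) : L :=
  [arg max_(l > xchoose (existsP (valP r)) | prefers_carsharing (val r) l)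
     fee D l]%O.

Definition levels (r : request) : {set L} :=
  [set l | fee D l <= fee D (req_level r)]%SET.

Definition preds (r : request) : {set request} :=
  [set r' | (req_orig r' == req_orig r) && (val r' < val r)%N]%SET.

Definition revenue (r : request) (l : L) : R :=
  minute_fee D * driving_time D (req_orig r) (req_dest r)
  - usage_cost D (req_orig r) (req_dest r) + fee D l.

Definition objective (y : V -> request -> L -> R) : R :=
  \sum_(r : request) \sum_(v : V) \sum_(l in levels r) revenue r l * y v r l.

(* The values y v r l with l \notin levels r occur nowhere. *)
Record second_stage_feasible (z : V -> I -> R) (lam : I -> I -> L -> R)
    (y : V -> request -> L -> R) : Prop := SecondStageFeasible {
  ss_binary : forall v r l, l \in levels r -> y v r l = 0 \/ y v r l = 1;
  ss_request : forall r, \sum_(v : V) \sum_(l in levels r) y v r l <= 1;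
  ss_vehicle : forall v,
    \sum_(r : request) \sum_(l in levels r) y v r l <= 1;
  ss_zone : forall r1 v,
    \sum_(l in levels r1) y v r1 l
    + \sum_(r2 in preds r1) \sum_(l in levels r2) y v r2 l
    <= z v (req_orig r1);
  ss_serve : forall r1 v l1, l1 \in levels r1 ->
    y v r1 l1
    + \sum_(r2 in preds r1) \sum_(l2 in levels r2) y v r2 l2
    + \sum_(v1 : V | v1 != v) y v1 r1 l1
    >= lam (req_orig r1) (req_dest r1) l1 + z v (req_orig r1) - 1;
  ss_level : forall r l, l \in levels r ->
    \sum_(v : V) y v r l <= lam (req_orig r) (req_dest r) l
}.

(* Supremum of a finite set of values; it is nonempty for every first-stage
   feasible (z, lam), so this is a maximum: see [Q_maximum]. *)
Definition Q (z : V -> I -> R) (lam : I -> I -> L -> R) : R :=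
  sup [set objective y | y in second_stage_feasible z lam].

End Realization.

Record first_stage_feasible (z : V -> I -> R) (lam : I -> I -> L -> R) : Prop :=
  FirstStageFeasible {
  fs_z_sum : forall v, \sum_(i : I) z v i = 1;
  fs_lam_sum : forall i j, \sum_(l : L) lam i j l = 1;
  fs_z_binary : forall v i, z v i = 0 \/ z v i = 1;
  fs_lam_binary : forall i j l, lam i j l = 0 \/ lam i j l = 1
}.

Record standing : Prop := Standing {
  relocation_cost_ge0 : forall v i, 0 <= relocation_cost D v i;
  prob_ge0 : forall s, 0 <= prob D s;
  prob_sum : \sum_(s < nS) prob D s = 1;
  same_utility : forall s k l v v',
    utility_vehicle (xi D s) k l v = utility_vehicle (xi D s) k l v'
}.

(* Constraints on (z, lam, phi). *)
Definition constraint :=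
  (V -> I -> R) -> (I -> I -> L -> R) -> ('I_nS -> R) -> Prop.

Definition linear_inequality (P : constraint) : Prop :=
  exists (a : V -> I -> R) (b : I -> I -> L -> R) (c : 'I_nS -> R) (d : R),
    forall z lam phi, P z lam phi <->
      \sum_(v : V) \sum_(i : I) a v i * z v i
      + \sum_(i : I) \sum_(j : I) \sum_(l : L) b i j l * lam i j l
      + \sum_(s < nS) c s * phi s <= d.

Definition optimality_cut (P : constraint) : Prop :=
  forall z lam phi, first_stage_feasible z lam ->
    (forall s, phi s <= Q (xi D s) z lam) -> P z lam phi.

Record valid_optimality_cuts (C : set constraint) : Prop :=
  ValidOptimalityCuts {
  cuts_finite : finite_set C;
  cuts_linear : forall P, C P -> linear_inequality P;
  cuts_enforce : forall z lam phi, first_stage_feasible z lam ->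
    (forall P, C P -> P z lam phi) -> forall s, phi s <= Q (xi D s) z lam;
  cuts_valid : forall P, C P -> optimality_cut P
}.

Definition Zplus (zt : V -> I -> R) : {set V * I} :=
  [set p | zt p.1 p.2 == 1]%SET.
Definition Zminus (zt : V -> I -> R) : {set V * I} :=
  [set p | zt p.1 p.2 == 0]%SET.
Definition Lplus (lamt : I -> I -> L -> R) : {set I * I * L} :=
  [set p | lamt p.1.1 p.1.2 p.2 == 1]%SET.
Definition Lminus (lamt : I -> I -> L -> R) : {set I * I * L} :=
  [set p | lamt p.1.1 p.1.2 p.2 == 0]%SET.

Definition cut (U : 'I_nS -> R) (zt : V -> I -> R) (lamt : I -> I -> L -> R)
    (s : 'I_nS) : constraint := fun z lam phi =>
  phi s <=
    (Q (xi D s) zt lamt - U s)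
      * (\sum_(p in Zplus zt) z p.1 p.2 - \sum_(p in Zminus zt) z p.1 p.2
         + \sum_(p in Lplus lamt) lam p.1.1 p.1.2 p.2
         - \sum_(p in Lminus lamt) lam p.1.1 p.1.2 p.2)
    + U s
    - (Q (xi D s) zt lamt - U s)
      * (#|Zplus zt|%:R + #|Lplus lamt|%:R - 1).

Definition cuts (U : 'I_nS -> R) : set constraint :=
  [set P | exists zt lamt s,
     first_stage_feasible zt lamt /\ P = cut U zt lamt s].

End Model.

Section Recourse.
Context {R : realType} {V I L A : finType} {nK nS : nat}.
Variables (D : instance R V I L A nK nS) (x : 'I_nK -> V + A -> R).
Implicit Types (z : V -> I -> R) (lam : I -> I -> L -> R).
Implicit Types (r : request D x) (v : V) (l : L).

Local Lemma sum_bool_le1 (T : finType) (P p : pred T) :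
  (forall a b, P a -> P b -> p a -> p b -> a = b) ->
  \sum_(t | P t) (p t)%:R <= 1 :> R.
Proof.
move=> p_inj; have [/existsP[a /andP[Pa pa]]|] := boolP [exists a, P a && p a].
  rewrite (bigD1 a) //= pa big1 ?addr0 // => b /andP[Pb].
  by apply: contraNeq; rewrite pnatr_eq0 eqb0 negbK => pb; apply/eqP/p_inj.
rewrite negb_exists => /forallP none; rewrite big1 // => a Pa.
by have := none a; rewrite Pa /=; case: (p a).
Qed.

(* Greedy assignment: in each zone the n-th customer willing to rent at the
   fee in force, in order of arrival, gets the n-th vehicle. *)
Lemma second_stage_feasible_exists z lam : first_stage_feasible z lam ->
  exists y : V -> request D x -> L -> R, second_stage_feasible z lam y.
Proof.
move=> [zsum lsum zbin lbin].
have z_uniq v i j : z v i = 1 -> z v j = 1 -> i = j.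
  move=> zi zj; apply: contra_eq (zsum v) => neq.
  rewrite (bigD1 i) //= (bigD1 j) ?(eq_sym j) //= zi zj addrA.
  rewrite gt_eqF // ltr_wpDr ?ltrDl // sumr_ge0 // => k _.
  by have [->|->] := zbin v k.
have l_uniq i j l m : lam i j l = 1 -> lam i j m = 1 -> l = m.
  move=> ll lm; apply: contra_eq (lsum i j) => neq.
  rewrite (bigD1 l) //= (bigD1 m) ?(eq_sym m) //= ll lm addrA.
  rewrite gt_eqF // ltr_wpDr ?ltrDl // sumr_ge0 // => k _.
  by have [->|->] := lbin i j k.
pose at_level r l := (l \in levels r) && (lam (req_orig r) (req_dest r) l == 1).
pose before r1 r2 := (val r1 <= val r2)%N.
pose ws i := sort before
  [seq r <- enum (request D x) | (req_orig r == i) && [exists l, at_level r l]].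
pose vs i := [seq v <- enum V | z v i == 1].
have in_ws r i : (r \in ws i) = (req_orig r == i) && [exists l, at_level r l].
  by rewrite mem_sort mem_filter mem_enum andbT.
have in_vs v i : (v \in vs i) = (z v i == 1) by rewrite mem_filter mem_enum andbT.
have uws i : uniq (ws i) by rewrite sort_uniq filter_uniq ?enum_uniq.
have uvs i : uniq (vs i) by rewrite filter_uniq ?enum_uniq.
have sws i : sorted before (ws i) by apply: sort_sorted => a b; exact: leq_total.
pose p v r l := [&& at_level r l, z v (req_orig r) == 1 &
  index v (vs (req_orig r)) == index r (ws (req_orig r))].
have r_ws v r l : p v r l -> r \in ws (req_orig r).
  by case/andP=> rl _; rewrite in_ws eqxx; apply/existsP; exists l.
have v_vs v r l : p v r l -> v \in vs (req_orig r).
  by case/and3P=> _ zv _; rewrite in_vs.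
have p_l v v' r l l' : p v r l -> p v' r l' -> l = l'.
  move=> /andP[/andP[_ /eqP h] _] /andP[/andP[_ /eqP h'] _].
  exact: l_uniq h h'.
have p_v v v' r l l' : p v r l -> p v' r l' -> v = v'.
  move=> h h'; have vin := v_vs _ _ _ h; have vin' := v_vs _ _ _ h'.
  case/and3P: h h' => _ _ /eqP h /and3P[_ _ /eqP h'].
  by rewrite -(nth_index v vin) -(nth_index v vin') h h'.
have p_r v r r' l l' : p v r l -> p v r' l' -> r = r'.
  move=> h h'; have rin := r_ws _ _ _ h; have rin' := r_ws _ _ _ h'.
  case/and3P: h h' => _ /eqP zr /eqP h /and3P[_ /eqP zr' /eqP h'].
  move: rin' h'; rewrite -(z_uniq _ _ _ zr zr') => rin' h'.
  by rewrite -(nth_index r rin) -(nth_index r rin') -h -h'.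
pose y v r l : R := (p v r l)%:R.
have y_ge0 v r l : 0 <= y v r l by exact: ler0n.
have ys_ge0 v (P : pred (request D x)) :
    0 <= \sum_(r | P r) \sum_(l in levels r) y v r l.
  by do 2![apply: sumr_ge0 => ? _].
exists y; split.
- by move=> v r l _; rewrite /y; case: (p _ _ _); [right|left].
- move=> r; rewrite pair_big_dep /=.
  apply: (@sum_bool_le1 _ _ (fun vl => p vl.1 r vl.2)) => -[v l] [v' l'] _ _ /=.
  by move=> h h'; rewrite (p_l _ _ _ _ _ h h') (p_v _ _ _ _ _ h h').
- move=> v; rewrite pair_big_dep /=.
  apply: (@sum_bool_le1 _ _ (fun rl => p v rl.1 rl.2)) => -[r l] [r' l'] _ _ /=.
  move=> h h'; have e := p_r _ _ _ _ _ h h'; subst r'.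
  by rewrite (p_l _ _ _ _ _ h h').
- move=> r1 v; have -> : \sum_(l in levels r1) y v r1 l
      + \sum_(r2 in preds r1) \sum_(l in levels r2) y v r2 l
      = \sum_(r in r1 |: preds r1) \sum_(l in levels r) y v r l.
    by rewrite big_setU1 //= inE ltnn andbF.
  have [z0|z1] := zbin v (req_orig r1).
    rewrite z0 big1 // => r; rewrite !inE => hr; rewrite big1 // => l _.
    have er : req_orig r = req_orig r1 by case/orP: hr => [/eqP ->|/andP[/eqP]].
    by rewrite /y /p er z0 eq_sym oner_eq0 andbF.
  rewrite z1 pair_big_dep /=.
  apply: (@sum_bool_le1 _ _ (fun rl => p v rl.1 rl.2)) => -[r l] [r' l'] _ _ /=.
  move=> h h'; have e := p_r _ _ _ _ _ h h'; subst r'.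
  by rewrite (p_l _ _ _ _ _ h h').
- move=> r1 v l1 l1r.
  have ge0 : 0 <= y v r1 l1 + \sum_(r2 in preds r1) \sum_(l2 in levels r2) y v r2 l2.
    by rewrite addr_ge0.
  have ge0' : 0 <= \sum_(v1 | v1 != v) y v1 r1 l1 by apply: sumr_ge0.
  have [lam0|lam1] := lbin (req_orig r1) (req_dest r1) l1.
    rewrite lam0 add0r (le_trans _ (addr_ge0 ge0 ge0')) // subr_le0.
    by have [->|->] := zbin v (req_orig r1).
  have [z0|z1] := zbin v (req_orig r1).
    by rewrite lam1 z0 addr0 subrr addr_ge0.
  rewrite lam1 z1 addrK.
  have atl : at_level r1 l1 by rewrite /at_level l1r lam1 eqxx.
  have r1in : r1 \in ws (req_orig r1).
    by rewrite in_ws eqxx; apply/existsP; exists l1.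
  have vin : v \in vs (req_orig r1) by rewrite in_vs z1.
  case: (ltngtP (index v (vs (req_orig r1))) (index r1 (ws (req_orig r1)))) => [lt|gt|e].
  + pose r2 := nth r1 (ws (req_orig r1)) (index v (vs (req_orig r1))).
    have sz : (index v (vs (req_orig r1)) < size (ws (req_orig r1)))%N.
      by rewrite (ltn_trans lt) // index_mem.
    have r2in : r2 \in ws (req_orig r1) by rewrite mem_nth.
    have /andP[/eqP or2 /existsP[l2 l2r]] : (req_orig r2 == req_orig r1)
        && [exists l, at_level r2 l] by rewrite -in_ws.
    have p2 : p v r2 l2 by rewrite /p l2r or2 z1 eqxx /= index_uniq.
    have r2p : r2 \in preds r1.
      rewrite inE or2 eqxx /= ltn_neqAle; apply/andP; split.
        rewrite (inj_eq val_inj) (inj_eq val_inj) -(nth_index r1 r1in) /r2.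
        by rewrite nth_uniq ?index_mem // ltn_eqF.
      rewrite -[X in (_ <= val (val X))%N](nth_index r1 r1in).
      apply: (sorted_leq_nth _ _ _ (sws (req_orig r1))) => //.
      * by move=> a b c; exact: leq_trans.
      * by move=> a; exact: leqnn.
      * by rewrite inE index_mem.
      * exact: ltnW.
    rewrite (bigD1 r2) //= (bigD1 l2) /=; last by case/andP: l2r.
    rewrite /y p2 -/y addrCA -!addrA lerDl !addr_ge0 //; apply: sumr_ge0 => // ? _.
    exact: sumr_ge0.
  + pose v1 := nth v (vs (req_orig r1)) (index r1 (ws (req_orig r1))).
    have sz : (index r1 (ws (req_orig r1)) < size (vs (req_orig r1)))%N.
      by rewrite (ltn_trans gt) // index_mem.
    have v1in : v1 \in vs (req_orig r1) by rewrite mem_nth.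
    have p1 : p v1 r1 l1.
      by rewrite /p atl -in_vs v1in /= index_uniq.
    have v1v : v1 != v.
      by rewrite -(nth_index v vin) nth_uniq ?index_mem // ltn_eqF.
    by rewrite (bigD1 v1) //= /y p1 -/y addrCA lerDl addr_ge0 // sumr_ge0.
  + have -> : y v r1 l1 = 1 by rewrite /y /p atl z1 e !eqxx.
    by rewrite -addrA lerDl addr_ge0.
- move=> r l lr; have [lam0|lam1] := lbin (req_orig r) (req_dest r) l.
    rewrite lam0 big1 // => v _.
    by rewrite /y /p /at_level lam0 eq_sym oner_eq0 andbF.
  rewrite lam1; apply: (@sum_bool_le1 _ _ (fun v => p v r l)) => v v' _ _ h h'.
  exact: p_v h h'.
Qed.

Local Lemma second_stage_feasible_eq z lam (y y' : V -> request D x -> L -> R) :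
  (forall v r l, l \in levels r -> y v r l = y' v r l) ->
  second_stage_feasible z lam y -> second_stage_feasible z lam y'.
Proof.
move=> yy' [h1 h2 h3 h4 h5 h6].
have e v r : \sum_(l in levels r) y v r l = \sum_(l in levels r) y' v r l.
  by apply: eq_bigr => l; exact: yy'.
have e2 v (P : pred (request D x)) : \sum_(r | P r) \sum_(l in levels r) y v r l
    = \sum_(r | P r) \sum_(l in levels r) y' v r l by apply: eq_bigr.
have e3 (P : pred V) r l : l \in levels r ->
    \sum_(v | P v) y v r l = \sum_(v | P v) y' v r l.
  by move=> lr; apply: eq_bigr => v _; exact: yy'.
split.
- by move=> v r l lr; rewrite -yy' //; exact: h1.
- by move=> r; rewrite -(eq_bigr _ (fun v _ => e v r)).
- by move=> v; rewrite -e2.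
- by move=> r v; rewrite -e -e2.
- by move=> r v l lr; rewrite -yy' // -e2 -e3 //; exact: h5.
- by move=> r l lr; rewrite -e3 //; exact: h6.
Qed.

Lemma Q_maximum z lam : first_stage_feasible z lam ->
  exists y : V -> request D x -> L -> R,
    [/\ second_stage_feasible z lam y, objective y = Q D x z lam &
    forall y' : V -> request D x -> L -> R,
      second_stage_feasible z lam y' -> objective y' <= Q D x z lam].
Proof.
move=> zlam; have [y0 y0f] := second_stage_feasible_exists zlam.
pose code (y : V -> request D x -> L -> R) : {ffun V * request D x * L -> bool} :=
  [ffun t => y t.1.1 t.1.2 t.2 == 1].
pose decode (b : {ffun V * request D x * L -> bool}) v r l : R := (b (v, r, l))%:R.
have decodeK y : second_stage_feasible z lam y -> forall v r l, l \in levels r ->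
    y v r l = decode (code y) v r l.
  move=> yf v r l lr; rewrite /decode ffunE /=.
  by have [->|->] := ss_binary yf v lr; rewrite ?eqxx // eq_sym oner_eq0.
have obj y : second_stage_feasible z lam y -> objective y = objective (decode (code y)).
  move=> yf; apply: eq_bigr => r _; apply: eq_bigr => v _.
  by apply: eq_bigr => l lr; rewrite decodeK.
pose feasb b := `[< second_stage_feasible z lam (decode b) >].
have feas y : second_stage_feasible z lam y ->
    feasb (code y).
  by move=> yf; apply/asboolP; exact: second_stage_feasible_eq (decodeK _ yf) yf.
have [b] := @arg_maxP _ _ _ _ feasb (fun b => objective (decode b)) (feas _ y0f).
move=> /asboolP bf bmax.
have bub (y : V -> request D x -> L -> R) :
    second_stage_feasible z lam y -> objective y <= objective (decode b).
  by move=> yf; rewrite obj //; exact: (bmax (code y) (feas _ yf)).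
have Qb : objective (decode b) = Q D x z lam.
  apply/eqP; rewrite eq_le; apply/andP; split.
    apply: ub_le_sup; last by exists (decode b).
    by exists (objective (decode b)) => _ [y yf <-]; exact: bub.
  apply: ge_sup; first by exists (objective (decode b)), (decode b).
  by move=> _ [y yf <-]; exact: bub.
by exists (decode b); rewrite -Qb; split.
Qed.
End Recourse.

(* Main.v *)
Require Import Defs.
From HB Require Import structures.
From mathcomp Require Import all_boot all_order all_algebra.
From mathcomp Require Import all_classical all_reals.
From mathcomp Require Import ring lra.

(** The cut built at the first-stage solution (zt, lamt) only sees how far
    another binary solution (z, lam) is from it.  Both signed sums in the cut
    are a cardinal minus a Hamming distance ([signed_sum_hamming]), so on
    binary points, with d the total distance to (zt, lamt), the cut reads
      phi s <= (Q(zt, lamt) - U s) * (1 - d) + U s      ([cut_hamming]).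
    At d = 0 the bound is Q(zt, lamt) itself, so the cut taken at (z, lam)
    enforces phi s <= Q(z, lam).  Distances are natural numbers, so at any other
    point d >= 1; as Q(zt, lamt) - U s <= 0, the bound is then at least U s,
    which dominates Q(z, lam), and nothing admissible is cut off.

    There are finitely many cuts because a first-stage solution is determined
    by a boolean function on a finite type, and each is linear because the
    signed sums are linear forms with coefficients in {-1, 0, 1}. *)

Set Implicit Arguments.
Unset Strict Implicit.
Unset Printing Implicit Defensive.
Import Order.TTheory GRing.Theory Num.Theory.
Local Open Scope ring_scope.

Section SignedSums.
Context {R : realType} {T : finType}.
Implicit Types a x : T -> R.

Definition sign_coef (c : R) : R := (c == 1)%:R - (c == 0)%:R.

Lemma signed_sum_linear a x :
  \sum_(t in [set t | a t == 1]%SET) x t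
  - \sum_(t in [set t | a t == 0]%SET) x t = \sum_t sign_coef (a t) * x t.
Proof.
rewrite (big_mkcond (mem [set t | a t == 1]%SET)) /=.
rewrite (big_mkcond (mem [set t | a t == 0]%SET)) /= -sumrB.
apply: eq_bigr => t _; rewrite /sign_coef !inE.
by case: (a t == 1); case: (a t == 0); rewrite /=; ring.
Qed.

Definition hamming a x : nat := #|[set t | a t != x t]%SET|.

Lemma hamming_eq0 a x : hamming a x = 0%N -> a =1 x.
Proof.
move=> /eqP; rewrite cards_eq0 => /eqP/setP e t.
by have := e t; rewrite !inE => /negbFE/eqP.
Qed.

Lemma hammingxx a : hamming a a = 0%N.
Proof. by apply: eq_card0 => t; rewrite !inE eqxx. Qed.

(** Every coordinate where x departs from a lowers the signed sum by one: it
    either loses a 1 counted positively or gains a 1 counted negatively. *)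
Lemma signed_sum_hamming a x :
  (forall t, a t = 0 \/ a t = 1) -> (forall t, x t = 0 \/ x t = 1) ->
  \sum_(t in [set t | a t == 1]%SET) x t
  - \sum_(t in [set t | a t == 0]%SET) x t
  = #|[set t | a t == 1]%SET|%:R - (hamming a x)%:R.
Proof.
move=> abin xbin; rewrite signed_sum_linear /hamming -!sum1_card !natr_sum.
rewrite (big_mkcond (mem [set t | a t == 1]%SET)) /=.
rewrite (big_mkcond (mem [set t | a t != x t]%SET)) /= -sumrB.
apply: eq_bigr => t _; rewrite /sign_coef !inE.
have n10 : (1 == 0 :> R) = false by rewrite oner_eq0.
have n01 : (0 == 1 :> R) = false by rewrite eq_sym oner_eq0.
by have [->|->] := abin t; have [->|->] := xbin t;
  rewrite ?eqxx ?n10 ?n01 /=; ring.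
Qed.

Lemma binary_charac_fun a : (forall t, a t = 0 \/ a t = 1) ->
  exists b : {ffun T -> bool}, forall t, a t = (b t)%:R.
Proof.
move=> abin; exists [ffun t => a t == 1] => t; rewrite ffunE.
by have [->|->] := abin t; rewrite ?eqxx // eq_sym oner_eq0.
Qed.

End SignedSums.

Section Cuts.
Context {R : realType} {V I L A : finType} {nK nS : nat}.
Variables (D : instance R V I L A nK nS) (U : 'I_nS -> R).
Implicit Types (z zt : V -> I -> R) (lam lamt : I -> I -> L -> R).

Definition first_stage_dist zt lamt z lam : nat :=
  hamming (fun p : V * I => zt p.1 p.2) (fun p => z p.1 p.2)
  + hamming (fun p : I * I * L => lamt p.1.1 p.1.2 p.2)
      (fun p => lam p.1.1 p.1.2 p.2).

Lemma first_stage_distxx z lam : first_stage_dist z lam z lam = 0%N.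
Proof. by rewrite /first_stage_dist !hammingxx. Qed.

Lemma first_stage_dist_eq0 zt lamt z lam :
  first_stage_dist zt lamt z lam = 0%N -> zt = z /\ lamt = lam.
Proof.
move=> /eqP; rewrite addn_eq0 => /andP[/eqP/hamming_eq0 ez /eqP/hamming_eq0 el].
split; first by apply/funext => v; apply/funext => i; exact: (ez (v, i)).
apply/funext => i; apply/funext => j; apply/funext => l.
exact: (el (i, j, l)).
Qed.

Lemma cut_hamming zt lamt s z lam phi :
  first_stage_feasible zt lamt -> first_stage_feasible z lam ->
  cut D U zt lamt s z lam phi <->
  phi s <= (Q D (xi D s) zt lamt - U s)
             * (1 - (first_stage_dist zt lamt z lam)%:R) + U s.
Proof.
move=> [_ _ ztbin ltbin] [_ _ zbin lbin]; rewrite /cut.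
have ez := @signed_sum_hamming R _ (fun p : V * I => zt p.1 p.2)
  (fun p => z p.1 p.2) (fun p => ztbin p.1 p.2) (fun p => zbin p.1 p.2).
have el := @signed_sum_hamming R _
  (fun p : I * I * L => lamt p.1.1 p.1.2 p.2) (fun p => lam p.1.1 p.1.2 p.2)
  (fun p => ltbin p.1.1 p.1.2 p.2) (fun p => lbin p.1.1 p.1.2 p.2).
rewrite /Zplus /Zminus /Lplus /Lminus -[X in _ * X]addrA ez el.
rewrite /first_stage_dist natrD.
by split; lra.
Qed.

Lemma cut_linear zt lamt s : linear_inequality (cut D U zt lamt s).
Proof.
pose q := Q D (xi D s) zt lamt - U s.
exists (fun v i => - q * sign_coef (zt v i)),
  (fun i j l => - q * sign_coef (lamt i j l)), (fun s' => (s' == s)%:R),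
  (U s - q * (#|Zplus zt|%:R + #|Lplus lamt|%:R - 1)) => z lam phi.
have ez := signed_sum_linear (fun p : V * I => zt p.1 p.2) (fun p => z p.1 p.2).
have el := signed_sum_linear (fun p : I * I * L => lamt p.1.1 p.1.2 p.2)
  (fun p => lam p.1.1 p.1.2 p.2).
have -> : \sum_v \sum_i - q * sign_coef (zt v i) * z v i
    = - q * \sum_(p : V * I) sign_coef (zt p.1 p.2) * z p.1 p.2.
  by rewrite pair_bigA mulr_sumr; apply: eq_bigr => p _; rewrite mulrA.
have -> : \sum_i \sum_j \sum_l - q * sign_coef (lamt i j l) * lam i j l
    = - q * \sum_(p : I * I * L)
        sign_coef (lamt p.1.1 p.1.2 p.2) * lam p.1.1 p.1.2 p.2.
  rewrite pair_bigA pair_bigA mulr_sumr.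
  by apply: eq_bigr => p _; rewrite mulrA.
have -> : \sum_(s' < nS) (s' == s)%:R * phi s' = phi s.
  rewrite (bigD1 s) //= eqxx mul1r big1 ?addr0 // => s' /negbTE ->.
  by rewrite mul0r.
rewrite -ez -el /cut -/q -[X in _ * X]addrA -/(Zplus zt) -/(Zminus zt).
rewrite -/(Lplus lamt) -/(Lminus lamt).
by split; lra.
Qed.

Lemma cuts_finite_set : finite_set (cuts D U).
Proof.
pose decode (c : {ffun V * I -> bool} * {ffun I * I * L -> bool} * 'I_nS) :=
  cut D U (fun v i => (c.1.1 (v, i))%:R)
    (fun i j l => (c.1.2 (i, j, l))%:R) c.2.
apply: (@sub_finite_set _ _ (decode @` setT)%classic); last first.
  exact/finite_image/finite_finset.
move=> _ [zt [lamt [s [[_ _ zbin lbin] ->]]]].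
have [b eb] := @binary_charac_fun R _ (fun p : V * I => zt p.1 p.2)
  (fun p => zbin p.1 p.2).
have [c ec] := @binary_charac_fun R _
  (fun p : I * I * L => lamt p.1.1 p.1.2 p.2) (fun p => lbin p.1.1 p.1.2 p.2).
exists (b, c, s) => //; rewrite /decode /=; congr (cut D U _ _ s).
  by apply/funext => v; apply/funext => i; rewrite -(eb (v, i)).
apply/funext => i; apply/funext => j; apply/funext => l.
by rewrite -(ec (i, j, l)).
Qed.

(** At distance 0 the terms in U s cancel and the bound is exactly Q. *)
Lemma cut_self z lam s phi : first_stage_feasible z lam ->
  cut D U z lam s z lam phi -> phi s <= Q D (xi D s) z lam.
Proof.
move=> zlam /(cut_hamming _ _ zlam zlam).
by rewrite first_stage_distxx subr0 mulr1 subrK.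
Qed.

(** Distances being integral, either the cut is taken at (z, lam) itself, or
    the factor 1 - d is nonpositive and the bound rises above U s. *)
Lemma cut_optimality zt lamt s :
  (forall z lam, first_stage_feasible z lam -> Q D (xi D s) z lam <= U s) ->
  first_stage_feasible zt lamt -> optimality_cut D (cut D U zt lamt s).
Proof.
move=> QU ztlamt z lam phi zlam phiQ; apply/(cut_hamming _ _ ztlamt zlam).
have [/first_stage_dist_eq0 [-> ->]|d_gt0] :=
  posnP (first_stage_dist zt lamt z lam).
  by rewrite first_stage_distxx subr0 mulr1 subrK.
apply: (le_trans (phiQ s)); apply: (le_trans (QU _ _ zlam)).
by rewrite lerDr mulr_le0 // subr_le0 ?QU // ler1n.
Qed.

End Cuts.

Theorem proposition4p1 (R : realType) (V I L A : finType) (nK nS : nat)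
    (D : instance R V I L A nK nS) (hD : standing D)
    (U : 'I_nS -> R)
    (hU : forall (s : 'I_nS) (z : V -> I -> R) (lam : I -> I -> L -> R),
        first_stage_feasible z lam -> Q D (xi D s) z lam <= U s) :
  valid_optimality_cuts D (cuts D U).
Proof.
split.
- exact: cuts_finite_set.
- by move=> _ [zt [lamt [s [_ ->]]]]; exact: cut_linear.
- move=> z lam phi zlam satisfied s; apply: (cut_self zlam).
  by apply: satisfied; exists z, lam, s.
- move=> _ [zt [lamt [s [ztlamt ->]]]].
  by apply: cut_optimality => // z lam; exact: hU.
Qed.
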